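(* Let $\mathscr A,\mathscr B$ be unital $C^*$-algebras, $\mathcal H$ a Hilbert space, and let $\Omega:\mathscr B\to B(\mathcal H)$ and $\Lambda:\mathscr A\to\mathscr B$ be completely positive maps. Let $(\pi,\mathcal K_\Omega,V)$ be a minimal Stinespring representation of $\Omega$ and $(\varphi,\mathcal L,S)$ a minimal Stinespring representation of $\pi\circ\Lambda$. Let $\mathcal K_{\Omega,\Lambda}$, $Q_{\Omega,\Lambda}$, $\Gamma_\Lambda^\Omega$ and $\mathcal T_\Lambda^\Omega$ be as defined in the context. Let $P\in\pi(\mathscr B)'$ be a projection. Then $\mathcal T_\Lambda^\Omega(P)$ is a projection if and only if $$\Gamma_\Lambda^\Omega(P)Q_{\Omega,\Lambda}=Q_{\Omega,\Lambda}\Gamma_\Lambda^\Omega(P).$$ Equivalently, with $\Omega_P(B)=V^*\pi(B)PV$, the sharp submap $\Omega_P\le\Omega$ remains sharp after pullback by $\Lambda$ (i.e. $\Omega_P\circ\Lambda$ is sharp relative to $\Omega\circ\Lambda$) if and only if the lifted projection $\Gamma_\Lambda^\Omega(P)$ reduces $\mathcal K_{\Omega,\Lambda}$.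
   Context: For completely positive maps, $\Phi\le\Psi$ means $\Psi-\Phi$ is completely positive. A Stinespring representation of a completely positive map $\Psi:\mathscr C\to B(\mathcal G)$ is a triple $(\sigma,\mathcal K,T)$ with $\sigma:\mathscr C\to B(\mathcal K)$ a unital $*$-representation, $T:\mathcal G\to\mathcal K$ bounded and $\Psi(C)=T^*\sigma(C)T$; it is minimal if $\mathcal K=\overline{\operatorname{span}}\{\sigma(C)T\xi\}$. Radon--Nikodym theorem (known): if $(\sigma,\mathcal K,T)$ is minimal and $\Phi$ is completely positive with $\Phi\le c\Psi$ for some $c\ge0$, there is a unique positive $E\in\sigma(\mathscr C)'$ with $\Phi(C)=T^*\sigma(C)ET$ for all $C$; it is denoted $\frac{\mathrm d\Phi}{\mathrm d\Psi}$. A completely positive $\Phi\le\Psi$ is called sharp relative to $\Psi$ if $\frac{\mathrm d\Phi}{\mathrm d\Psi}$ is a projection. Setting: $\Omega(B)=V^*\pi(B)V$ and $\pi(\Lambda(A))=S^*\varphi(A)S$ are the minimal Stinespring representations on $\mathcal K_\Omega$ and $\mathcal L$. Put $\mathcal K_{\Omega,\Lambda}=\overline{\operatorname{span}}\{\varphi(A)SV\xi:A\in\mathscr A,\xi\in\mathcal H\}\subseteq\mathcal L$, which reduces $\varphi(\mathscr A)$; let $Q_{\Omega,\Lambda}$ be the orthogonal projection of $\mathcal L$ onto it, $\rho(A)=\varphi(A)|_{\mathcal K_{\Omega,\Lambda}}$ and $W=SV$. Then $(\rho,\mathcal K_{\Omega,\Lambda},W)$ is a minimal Stinespring representation of $\Omega\circ\Lambda$.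 Lift: for $D\in\pi(\mathscr B)'$, $\Gamma_\Lambda^\Omega(D)\in\varphi(\mathscr A)'$ is the unique bounded operator with $\Gamma_\Lambda^\Omega(D)\varphi(A)S\eta=\varphi(A)SD\eta$ for all $A\in\mathscr A$, $\eta\in\mathcal K_\Omega$; $\Gamma_\Lambda^\Omega$ is a unital $*$-homomorphism. Pullback transfer map: for positive $D\in\pi(\mathscr B)'$ let $\Omega_D(B)=V^*\pi(B)DV$, and let $\mathcal T_\Lambda^\Omega(D)=\frac{\mathrm d(\Omega_D\circ\Lambda)}{\mathrm d(\Omega\circ\Lambda)}\in\rho(\mathscr A)'$, computed in $(\rho,\mathcal K_{\Omega,\Lambda},W)$; $\mathcal T_\Lambda^\Omega$ is extended linearly to $\pi(\mathscr B)'$. *)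

(* Defs.v *)
From HB Require Import structures.
From mathcomp Require Import all_boot all_order all_algebra sesquilinear.
From mathcomp Require Import boolp classical_sets functions reals.
From mathcomp Require Import topology normedtype.
From mathcomp.real_closed Require Import complex.

Set Implicit Arguments.
Unset Strict Implicit.
Unset Printing Implicit Defensive.

Import Order.TTheory GRing.Theory Num.Theory.
Import numFieldNormedType.Exports.

Local Open Scope classical_set_scope.
Local Open Scope ring_scope.
Local Open Scope complex_scope.

(* The inner product is linear in the first variable and conjugate-linear in
   the second one. *)
HB.mixin Record CompleteNormedModule_isHilbert (R : realType) H
    & CompleteNormedModule R[i] H := {
  inner : {dot H for (@Num.conj R[i])} ;
  inner_norm : forall x : H, inner x x = `|x| ^+ 2
}.

#[short(type="hilbertType")]
HB.structure Definition Hilbert (R : realType) :=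
  {H of CompleteNormedModule R[i] H & CompleteNormedModule_isHilbert R H}.

(* The product is a field of the mixin because Hierarchy Builder accepts no
   join of normed modules and rings below numDomainType; the ring structure is
   declared right after. The zero algebra is not excluded. *)
HB.mixin Record CompleteNormedModule_isCStarAlgebra (R : realType) A
    & CompleteNormedModule R[i] A := {
  cstar_one : A ;
  cstar_mul : A -> A -> A ;
  cstar_mulA : associative cstar_mul ;
  cstar_mul1r : left_id cstar_one cstar_mul ;
  cstar_mulr1 : right_id cstar_one cstar_mul ;
  cstar_mulDl : left_distributive cstar_mul +%R ;
  cstar_mulDr : right_distributive cstar_mul +%R ;
  cstar_scaleAl : forall (c : R[i]) (x y : A),
    c *: cstar_mul x y = cstar_mul (c *: x) y ;
  cstar_scaleAr : forall (c : R[i]) (x y : A),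
    c *: cstar_mul x y = cstar_mul x (c *: y) ;
  star : A -> A ;
  starD : forall x y : A, star (x + y) = star x + star y ;
  starZ : forall (c : R[i]) (x : A), star (c *: x) = Num.conj c *: star x ;
  starM : forall x y : A, star (cstar_mul x y) = cstar_mul (star y) (star x) ;
  starK : involutive star ;
  cstar_normM : forall x y : A, `|cstar_mul x y| <= `|x| * `|y| ;
  cstar_norm : forall x : A, `|cstar_mul (star x) x| = `|x| ^+ 2
}.

#[short(type="cstarType")]
HB.structure Definition CStarAlgebra (R : realType) :=
  {A of CompleteNormedModule R[i] A & CompleteNormedModule_isCStarAlgebra R A}.

#[non_forgetful_inheritance]
HB.instance Definition _ (R : realType) (A : cstarType R) :=
  GRing.Zmodule_isPzRing.Build (CStarAlgebra.sort A) (@cstar_mulA R A)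
    (@cstar_mul1r R A) (@cstar_mulr1 R A) (@cstar_mulDl R A) (@cstar_mulDr R A).


Section Subspaces.
Context {R : realType} {H : hilbertType R}.
Implicit Types U G : set H.

Definition is_subspace U : Prop := submod_closed (mem U).

Definition span G : set H := smallest is_subspace G.

Lemma is_subspaceP U : is_subspace U <->
  U 0 /\ forall (c : R[i]) x y, U x -> U y -> U (c *: x + y).
Proof.
split=> [[U0 UD]|[U0 UD]].
  split=> [|c x y Ux Uy]; first by have := U0; rewrite inE.
  by have := UD c x y; rewrite !inE; apply.
split=> [|c x y]; first by rewrite inE.
by rewrite !inE; exact: UD.
Qed.

Lemma span_subspace G : is_subspace (span G).
Proof.
apply/is_subspaceP; split=> [U [/is_subspaceP[U0 _] _]//|c x y sx sy U UG].
have [/is_subspaceP[_ UD] _] := UG.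
by apply: UD; [exact: sx|exact: sy].
Qed.

Lemma closure_subspace U : is_subspace U -> is_subspace (closure U).
Proof.
move=> /is_subspaceP[U0 UD]; apply/is_subspaceP.
split=> [|c x y Ux Uy B nB]; first exact: subset_closure.
have : (fun z : H * H => c *: z.1 + z.2) @ (x, y) --> c *: x + y.
  apply: cvgD; last exact: cvg_snd.
  by apply: cvgZr; exact: cvg_fst.
move=> /(_ _ nB) [[B1 B2] /= [nB1 nB2] sB].
have [a [Ua Ba]] := Ux _ nB1; have [b [Ub Bb]] := Uy _ nB2.
exists (c *: a + b); split; first exact: UD.
exact: (sB (a, b)).
Qed.

End Subspaces.

Record closedSubspace (R : realType) (H : hilbertType R) := ClosedSubspace {
  cs_set :> set H ;
  cs_subspace : is_subspace cs_set ;
  cs_closed : closed cs_set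
}.

Definition closed_span (R : realType) (H : hilbertType R) (G : set H) :=
  ClosedSubspace (closure_subspace (span_subspace G))
    (@closed_closure _ (span G)).

Section SubspaceType.
Context {R : realType} {H : hilbertType R} (U : closedSubspace H).

Definition cs_pred : {pred H} := mem (U : set H).

HB.instance Definition _ :=
  GRing.isSubmodClosed.Build R[i] H cs_pred
    (GRing.submod_closed_semi (cs_subspace U)).

Record cs_type := CsType { cs_val : H ; cs_valP : cs_val \in cs_pred }.

HB.instance Definition _ := [isSub for cs_val].
HB.instance Definition _ := [Choice of cs_type by <:].
HB.instance Definition _ := [SubChoice_isSubLmodule of cs_type by <:].

Let cs_norm (u : cs_type) : R[i] := `|cs_val u|.

Let cs_normD u v : cs_norm (u + v) <= cs_norm u + cs_norm v.
Proof. exact: ler_normD. Qed.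

Let cs_normZ (c : R[i]) u : cs_norm (c *: u) = `|c| * cs_norm u.
Proof. exact: normrZ. Qed.

Let cs_norm_eq0 u : cs_norm u = 0 -> u = 0.
Proof. by move=> /normr0_eq0 u0; apply: val_inj. Qed.

HB.instance Definition _ :=
  Lmodule_isNormed.Build R[i] cs_type cs_normD cs_normZ cs_norm_eq0.

Let cs_complete (F : set_system cs_type) :
  ProperFilter F -> cauchy F -> cvg F.
Proof.
move=> FF Fc.
have Gc : cauchy (cs_val @ F).
  apply/cauchyP => e e0; have /cauchyP/(_ e e0)[x Fx] := Fc.
  by exists (cs_val x); move: Fx; rewrite -!ball_normE.
have [l Gl] : exists l : H, cs_val @ F --> l.
  by apply/cvg_ex; exact: cauchy_cvg.
have Ul : l \in cs_pred.
  rewrite inE; apply: (cs_closed (c := U)) => B /Gl FB.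
  have [u Bu] : exists u, B (cs_val u) by exact: (@filter_ex _ F _ _ FB).
  by exists (cs_val u); split => //; rewrite -inE; exact: cs_valP.
apply/cvg_ex; exists (CsType Ul).
apply/cvgrPdist_lt => e e0.
have /cvgrPdist_lt/(_ e e0) := Gl.
exact.
Qed.

HB.instance Definition _ := Uniform_isComplete.Build cs_type cs_complete.

Definition cs_inner (u v : cs_type) : R[i] := inner (cs_val u) (cs_val v).

Let cs_inner_bilinear :
  bilinear_for *%R (@Num.conj R[i] \; *%R) cs_inner.
Proof.
split=> [v|u] c x y; rewrite /cs_inner.
  by rewrite (_ : cs_val (c *: x + y) = c *: cs_val x + cs_val y) ?linearPl.
by rewrite (_ : cs_val (c *: x + y) = c *: cs_val x + cs_val y) ?linearPr.
Qed.

HB.instance Definition _ :=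
  bilinear_isBilinear.Build R[i] cs_type cs_type R[i] *%R
    (@Num.conj R[i] \; *%R) cs_inner cs_inner_bilinear.

Let cs_inner_hermitian u v :
  cs_inner u v = (-1) ^+ false * Num.conj (cs_inner v u).
Proof. exact: hermitian_subproof. Qed.

HB.instance Definition _ :=
  isHermitianSesquilinear.Build R[i] cs_type false (@Num.conj R[i]) cs_inner
    cs_inner_hermitian.

Let cs_inner_gt0 u : u != 0 -> 0 < cs_inner u u.
Proof. by move=> u0; apply: neq0_dnorm_gt0; rewrite -(inj_eq val_inj) in u0. Qed.

HB.instance Definition _ :=
  isDotProduct.Build R[i] cs_type cs_inner cs_inner_gt0.

Let cs_inner_norm (u : cs_type) : cs_inner u u = `|u| ^+ 2.
Proof. exact: inner_norm. Qed.

HB.instance Definition _ :=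
  CompleteNormedModule_isHilbert.Build R cs_type cs_inner_norm.

End SubspaceType.

Definition bounded_op (R : realType) (H K : hilbertType R) (T : H -> K) : Prop :=
  linear T /\ exists M : R[i], forall x, `|T x| <= M * `|x|.

(* Below, [xget x0 E] picks the unique element of [E] ([x0] is a dummy value for
   the case where [E] is empty). *)

Definition adjoint (R : realType) (H K : hilbertType R) (T : H -> K) : K -> H :=
  xget (cst 0) [set T' | forall x y, inner (T x) y = inner x (T' y)].

Definition positive_op (R : realType) (H : hilbertType R) (D : H -> H) : Prop :=
  bounded_op D /\ forall x, 0 <= inner (D x) x.

Definition projection_op (R : realType) (H : hilbertType R) (P : H -> H) : Prop :=
  [/\ bounded_op P, P \o P = P & adjoint P = P].

Definition orth_projection (R : realType) (H : hilbertType R)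
    (U : closedSubspace H) : H -> H :=
  xget (cst 0) [set Q | forall x, Q x \in (U : set H) /\
                 forall y, y \in (U : set H) -> inner (x - Q x) y = 0].

Definition orth_compl (R : realType) (H : hilbertType R) (U : set H) : set H :=
  [set x | forall y, U y -> inner x y = 0].

Definition reduces (R : realType) (H : hilbertType R) (T : H -> H)
    (U : set H) : Prop :=
  (forall x, U x -> U (T x)) /\
  (forall x, orth_compl U x -> orth_compl U (T x)).

(* Positivity in the C*-algebra M_n(A), whose involution is the conjugate
   transpose. *)
Definition positive_mx (R : realType) (A : cstarType R) (n : nat)
    (M : 'M[A]_n) : Prop :=
  exists X : 'M[A]_n, M = (map_mx star X)^T *m X.

Definition completely_positive (R : realType) (A B : cstarType R)
    (Phi : A -> B) : Prop :=
  linear Phi /\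
  forall (n : nat) (M : 'M[A]_n), positive_mx M -> positive_mx (map_mx Phi M).

(* Complete positivity for maps into B(H), where M_n(B(H)) is identified with
   B(H^n). *)
Definition completely_positive_op (R : realType) (A : cstarType R)
    (H : hilbertType R) (Phi : A -> H -> H) : Prop :=
  [/\ linear Phi, forall a, bounded_op (Phi a) &
    forall (n : nat) (M : 'M[A]_n), positive_mx M ->
    forall xi : 'I_n -> H,
      0 <= \sum_(i < n) inner (\sum_(j < n) Phi (M i j) (xi j)) (xi i)].

Definition cp_le (R : realType) (A : cstarType R) (H : hilbertType R)
    (Phi Psi : A -> H -> H) : Prop :=
  completely_positive_op (Psi - Phi).

Definition star_representation (R : realType) (A : cstarType R)
    (K : hilbertType R) (sigma : A -> K -> K) : Prop :=
  [/\ linear sigma,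
      forall a, bounded_op (sigma a),
      sigma 1 = id,
      forall a b, sigma (a * b) = sigma a \o sigma b &
      forall a, sigma (star a) = adjoint (sigma a)].

Definition stinespring (R : realType) (A : cstarType R) (H K : hilbertType R)
    (Psi : A -> H -> H) (sigma : A -> K -> K) (T : H -> K) : Prop :=
  [/\ star_representation sigma, bounded_op T &
      forall a, Psi a = adjoint T \o sigma a \o T].

Definition minimal_stinespring (R : realType) (A : cstarType R)
    (H K : hilbertType R) (Psi : A -> H -> H) (sigma : A -> K -> K)
    (T : H -> K) : Prop :=
  stinespring Psi sigma T /\
  closure (span [set sigma a (T xi) | a in setT & xi in setT]) = setT.

Definition commutant (R : realType) (A : cstarType R) (K : hilbertType R)
    (sigma : A -> K -> K) : set (K -> K) :=
  [set E | bounded_op E /\ forall a, E \o sigma a = sigma a \o E].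

(* The derivative dPhi/dPsi computed in the minimal Stinespring representation
   (sigma, K, T) of Psi. *)
Definition radon_nikodym (R : realType) (A : cstarType R) (H K : hilbertType R)
    (sigma : A -> K -> K) (T : H -> K) (Phi : A -> H -> H) : K -> K :=
  xget (cst 0) [set E | [/\ positive_op E, commutant sigma E &
                 forall a, Phi a = adjoint T \o sigma a \o E \o T]].

(* Phi is sharp relative to Psi, where (sigma, K, T) is the minimal Stinespring
   representation of Psi used to compute dPhi/dPsi. *)
Definition sharp (R : realType) (A : cstarType R) (H K : hilbertType R)
    (sigma : A -> K -> K) (T : H -> K) (Phi Psi : A -> H -> H) : Prop :=
  [/\ completely_positive_op Phi, cp_le Phi Psi &
      projection_op (radon_nikodym sigma T Phi)].

(* [submap pi V D] is the map Omega_D, where Omega = V^* pi V. *)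
Definition submap (R : realType) (B : cstarType R) (H K : hilbertType R)
    (pi : B -> K -> K) (V : H -> K) (D : K -> K) : B -> H -> H :=
  fun b => adjoint V \o pi b \o D \o V.

Definition lift_op (R : realType) (A : cstarType R) (K L : hilbertType R)
    (phi : A -> L -> L) (S : K -> L) (D : K -> K) : L -> L :=
  xget (cst 0) [set G | commutant phi G /\
                 forall a eta, G (phi a (S eta)) = phi a (S (D eta))].

(* [pullback_space], [pullback_rep] and [pullback_op] form the minimal
   Stinespring representation (rho, K_{Omega,Lambda}, W) of Omega o Lambda. *)
Definition pullback_space (R : realType) (A : cstarType R)
    (H K L : hilbertType R) (V : H -> K) (phi : A -> L -> L) (S : K -> L) :
    closedSubspace L :=
  closed_span [set phi a (S (V xi)) | a in setT & xi in setT].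

(* [insubd 0 y] is [y] seen as an element of the subspace when [y] belongs to
   it, which is always the case in the next two definitions. *)
Definition pullback_rep (R : realType) (A : cstarType R)
    (H K L : hilbertType R) (V : H -> K) (phi : A -> L -> L) (S : K -> L) :
    A -> cs_type (pullback_space V phi S) -> cs_type (pullback_space V phi S) :=
  fun a x => insubd 0 (phi a (val x)).

Arguments pullback_rep {R A H K L} V phi S a x.

Definition pullback_op (R : realType) (A : cstarType R)
    (H K L : hilbertType R) (V : H -> K) (phi : A -> L -> L) (S : K -> L) :
    H -> cs_type (pullback_space V phi S) :=
  fun xi => insubd 0 (S (V xi)).

(* The pullback transfer map: linear on the commutant of pi, given by
   d(Omega_D o Lambda)/d(Omega o Lambda) at positive D; its values outside the
   commutant of pi are irrelevant. *)
Definition transfer_map (R : realType) (A B : cstarType R)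
    (H K L : hilbertType R) (Lambda : A -> B) (pi : B -> K -> K) (V : H -> K)
    (phi : A -> L -> L) (S : K -> L) :
    (K -> K) -> cs_type (pullback_space V phi S) ->
    cs_type (pullback_space V phi S) :=
  xget (cst (cst 0))
    [set T | [/\
      forall D, commutant pi D ->
        commutant (pullback_rep V phi S) (T D),
      forall (c : R[i]) D E, commutant pi D -> commutant pi E ->
        T (c *: D + E) = c *: T D + T E &
      forall D, commutant pi D -> positive_op D ->
        T D = radon_nikodym (pullback_rep V phi S)
                (pullback_op V phi S) (submap pi V D \o Lambda)]].
Arguments transfer_map {R A B H K L} Lambda pi V phi S D x : rename.

(* Main.v *)
From mathcomp Require Import all_boot all_order all_algebra sesquilinear ring.
From mathcomp Require Import boolp classical_sets functions reals.
From mathcomp Require Import topology normedtype.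
From mathcomp.real_closed Require Import complex.
Require Import Defs.

(* Let G be the lift of P and Q the projection onto U = K_{Omega,Lambda}. The
   derivative of Omega_P o Lambda is the compression Q G restricted to U. If
   it is idempotent then |Q G x| = |G x| for every x in U, so G maps U into
   itself; as G is selfadjoint this means that G commutes with Q, that is,
   that G reduces U.

   The lift exists because, for D and E in the commutant of pi, a positive
   matrix X^* X = [Lambda(a_j^* a_i)] gives
     <sum_i phi(a_i) S D eta_i, sum_j phi(a_j) S E eta_j>
       = sum_k <D y_k, E y_k>  with  y_k = sum_i pi(X_ki) eta_i;
   D = E gives boundedness and E = id gives positivity of the lift. *)

Set Implicit Arguments.
Unset Strict Implicit.
Unset Printing Implicit Defensive.

Import Order.TTheory GRing.Theory Num.Theory.
Import numFieldNormedType.Exports.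

Local Open Scope classical_set_scope.
Local Open Scope ring_scope.
Local Open Scope complex_scope.

(** * Inner products: sesquilinearity and the Cauchy-Schwarz inequality *)

Section Inner.
Context {R : realType} {H : hilbertType R}.
Implicit Types x y z : H.

Lemma innerC x y : inner x y = Num.conj (inner y x).
Proof. by rewrite hermC expr0 mul1r. Qed.

Lemma innerDl x y z : inner (x + y) z = inner x z + inner y z.
Proof. exact: linearDl. Qed.

Lemma innerDr x y z : inner z (x + y) = inner z x + inner z y.
Proof. exact: linearDr. Qed.

Lemma innerBl x y z : inner (x - y) z = inner x z - inner y z.
Proof. exact: linearBl. Qed.

Lemma innerBr x y z : inner z (x - y) = inner z x - inner z y.
Proof. exact: linearBr. Qed.

Lemma innerZl (c : R[i]) x z : inner (c *: x) z = c * inner x z.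
Proof. by rewrite linearZl_LR. Qed.

Lemma innerZr (c : R[i]) x z : inner z (c *: x) = Num.conj c * inner z x.
Proof. by rewrite linearZr_LR. Qed.

Lemma inner0l z : inner 0 z = 0.
Proof. exact: linear0l. Qed.

Lemma inner0r z : inner z 0 = 0.
Proof. exact: linear0r. Qed.

Lemma inner_suml I (r : seq I) (F : I -> H) z :
  inner (\sum_(i <- r) F i) z = \sum_(i <- r) inner (F i) z.
Proof. by rewrite linear_sumlz. Qed.

Lemma inner_sumr I (r : seq I) (F : I -> H) z :
  inner z (\sum_(i <- r) F i) = \sum_(i <- r) inner z (F i).
Proof. by rewrite linear_sumr. Qed.

Lemma inner_ge0 x : 0 <= inner x x.
Proof. exact: dnorm_ge0. Qed.

Lemma inner_eq0 x : inner x x = 0 -> x = 0.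
Proof. by move=> /eqP; rewrite dnorm_eq0 => /eqP. Qed.

Lemma inner_le x y : `|inner x y| <= `|x| * `|y|.
Proof.
have [->|y0] := eqVneq y 0; first by rewrite inner0r !normr0 mulr0.
have yy0 : 0 < inner y y by rewrite dnorm_gt0.
rewrite -(@ler_pXn2r _ 2) ?nnegrE ?mulr_ge0 // exprMn -!inner_norm.
rewrite -(ler_pM2l yy0) -subr_ge0.
(* This vector is [inner y y] times the component of [x] orthogonal to [y]; expanding its square
   gives the inequality multiplied by [inner y y]. *)
have := inner_ge0 (inner y y *: x - inner x y *: y).
suff -> : inner (inner y y *: x - inner x y *: y)
    (inner y y *: x - inner x y *: y) =
    inner y y * (inner x x * inner y y) - inner y y * `|inner x y| ^+ 2 by [].
rewrite normCK innerBl !innerBr !innerZl !innerZr -!innerC.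
rewrite (innerC y x); ring.
Qed.

Lemma inner_extl x y : (forall z, inner x z = inner y z) -> x = y.
Proof.
move=> xy; apply/eqP; rewrite -subr_eq0; apply/eqP/inner_eq0.
by rewrite innerBl xy subrr.
Qed.

Lemma inner_extr x y : (forall z, inner z x = inner z y) -> x = y.
Proof. by move=> xy; apply: inner_extl => z; rewrite innerC xy -innerC. Qed.

End Inner.

(** * Epsilon criteria for closures and scalars *)

Lemma closure_normP (R : realType) (H : hilbertType R) (U : set H) x :
  closure U x <-> forall e : R[i], 0 < e -> exists2 u, U u & `|x - u| < e.
Proof.
split=> [Ux e e0|Ux B /nbhs_normP[e /= e0 eB]].
  have [u [Uu xu]] := Ux _ (nbhsx_ballx x e e0).
  by exists u => //; move: xu; rewrite -ball_normE.
by have [u Uu xu] := Ux e e0; exists u; split=> //; apply: eB.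
Qed.

Lemma eq0_le_pos (K : numFieldType) (x : K) :
  (forall e, 0 < e -> `|x| <= e) -> x = 0.
Proof.
move=> xe; apply/eqP/negPn/negP; rewrite -normr_gt0 => x0.
have /xe : 0 < `|x| / 2 by rewrite divr_gt0.
by rewrite ler_pdivlMr // ger_pMr // lern1.
Qed.

Lemma addC_conj_real (C : numClosedFieldType) (z : C) :
  z + Num.conj z \is Num.real.
Proof. by apply/CrealP; rewrite rmorphD /= conjCK addrC. Qed.

Section ConjComplex.
Context {R : realType}.
Implicit Types z w : R[i].

Lemma conjK z : Num.conj (Num.conj z) = z. Proof. exact: conjCK. Qed.

Lemma conjD z w : Num.conj (z + w) = Num.conj z + Num.conj w.
Proof. exact: rmorphD. Qed.

Lemma conjB z w : Num.conj (z - w) = Num.conj z - Num.conj w.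
Proof. exact: rmorphB. Qed.

Lemma conjM z w : Num.conj (z * w) = Num.conj z * Num.conj w.
Proof. exact: rmorphM. Qed.

End ConjComplex.

(** * Riesz representation of a bounded functional on a subspace *)

Section Riesz.
Context {R : realType} {H : hilbertType R}.
Variables (U : set H) (f : H -> R[i]) (M : R[i]).
Hypothesis subU : is_subspace U.
Hypothesis linf : forall (c : R[i]) x y,
  U x -> U y -> f (c *: x + y) = c * f x + f y.
Hypothesis bndf : forall x, U x -> `|f x| <= M * `|x|.

(* If [y] represents [f], then [q x] is |x - y|^2 - |y|^2. *)
Let q x : R[i] := inner x x - (f x + Num.conj (f x)).

Let U0 : U 0. Proof. by have /is_subspaceP[] := subU. Qed.

Let UP (c : R[i]) x y : U x -> U y -> U (c *: x + y).
Proof. by have /is_subspaceP[_] := subU; exact. Qed.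

Let real_q x : q x \is Num.real.
Proof.
apply: realB; first by rewrite ger0_real // inner_ge0.
exact: addC_conj_real.
Qed.

(** Since [|f x|] is at most [|M| * |x|], the sum of [q x] and [|M|^2] dominates the square of
    [|x| - |M|], so [q] is bounded below. *)
Let q_inf : exists m : R[i], (forall x, U x -> m <= q x) /\
  forall e, 0 < e -> exists2 x, U x & q x < m + e.
Proof.
have q_ge x : U x -> - `|M| ^+ 2 <= q x.
  move=> Ux; rewrite -subr_ge0 opprK /q inner_norm.
  have : f x + Num.conj (f x) <= (`|M| * `|x|) *+ 2.
    apply: le_trans (_ : `|f x| *+ 2 <= _); last first.
      rewrite lerMn2r /=; have := bndf Ux.
      move=> /[dup] /(le_trans (normr_ge0 _)) /ger0_norm <-.
      by rewrite normrM normr_id.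
    have fr : f x + Num.conj (f x) \is Num.real.
      exact: addC_conj_real.
    apply: le_trans (real_ler_norm fr) _; apply: le_trans (ler_normD _ _) _.
    by rewrite norm_conjC -mulr2n.
  rewrite -subr_ge0 => le2; have xM : 0 <= (`|x| - `|M|) ^+ 2.
    by rewrite real_exprn_even_ge0 // realB // ger0_real.
  apply: le_trans (addr_ge0 xM le2) _; rewrite le_eqVlt; apply/orP; left.
  by apply/eqP; ring.
(* The values of [q] are real, so the infimum is formed in [R] from their real parts and cast back
   to [R[i]]. *)
pose E := [set complex.Re (q x) | x in U].
have [reM Mre] : exists r : R, r%:C = - `|M| ^+ 2.
  have /complex_realP[r ->] : - `|M| ^+ 2 \is Num.real.
    by rewrite realN realX // ger0_real.
  by exists r.
have lbE : lbound E reM.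
  by move=> _ [x Ux <-]; rewrite -lecR RRe_real // Mre q_ge.
have infE : has_inf E.
  by split; [exists (complex.Re (q 0)), 0|exists reM].
exists (inf E)%:C; split=> [x Ux|e e0].
  rewrite -[q x]RRe_real // lecR; apply: ge_inf; first by case: infE.
  by exists x.
have /complex_realP[r er] := gtr0_real e0.
have r0 : 0 < r by rewrite -ltcR -er.
have [_ [x Ux <-] lt] := inf_adherent r0 infE.
by exists x => //; rewrite -[q x]RRe_real // er -rmorphD ltcR.
Qed.

(** A near-minimizer [u] nearly represents [f]: moving [u] along [x] by [s * Num.conj w] lowers [q]
    by at least [|w|^2 * s], and [q] cannot fall below [m]. *)
Let q_near m (em : forall x, U x -> m <= q x) e u x :
  U u -> U x -> q u < m + e ->
  `|f x - inner x u| ^+ 2 <= e * (1 + `|x| ^+ 2).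
Proof.
move=> Uu Ux que; set w := f x - inner x u.
have wE : inner x u = f x - w by rewrite /w; ring.
clearbody w.
have x1 : 0 < 1 + `|x| ^+ 2 by rewrite ltr_pwDl // exprn_ge0.
pose s := (1 + `|x| ^+ 2)^-1.
have s0 : 0 < s by rewrite invr_gt0.
have cs : Num.conj s = s by apply/CrealP; rewrite ger0_real // ltW.
rewrite -ler_pdivrMr // -/s.
have := em _ (UP (s * Num.conj w) Ux Uu).
have -> : q ((s * Num.conj w) *: x + u) =
    q u - `|w| ^+ 2 * s - `|w| ^+ 2 * s ^+ 2.
  have -> : `|w| ^+ 2 * s ^+ 2 =
      `|w| ^+ 2 * s - `|w| ^+ 2 * s ^+ 2 * inner x x.
    rewrite inner_norm -[X in X - _]mulr1
      -(@mulfV _ (1 + `|x| ^+ 2)) ?gt_eqF //.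
    by rewrite -/s; ring.
  rewrite /q linf // innerDl !innerDr !innerZl !innerZr normCK.
  rewrite !(conjD, conjM) conjK cs (innerC u x) wE conjB.
  ring.
rewrite -subr_ge0 => h1; rewrite -subr_ge0; rewrite -subr_gt0 in que.
have ws0 : 0 <= `|w| ^+ 2 * s ^+ 2 by rewrite mulr_ge0 ?exprn_ge0 // ltW.
apply: le_trans (addr_ge0 (addr_ge0 h1 (ltW que)) ws0) _.
by rewrite le_eqVlt; apply/orP; left; apply/eqP; ring.
Qed.

(** Parallelogram identity: the midpoint of two near-minimizers still has [q] at least [m], which
    forces them to be close. *)
Let q_cauchy m (em : forall x, U x -> m <= q x) e u v :
  U u -> U v -> q u < m + e -> q v < m + e -> `|u - v| ^+ 2 < 4 * e.
Proof.
move=> Uu Uv; rewrite -!(subr_gt0 (q _)) => qu qv.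
have Uv2 : U (2^-1 *: v) by rewrite -[_ *: _]addr0; exact: UP.
have := em _ (UP 2^-1 Uu Uv2); rewrite -subr_ge0 => h.
rewrite -subr_gt0.
have -> : 4 * e - `|u - v| ^+ 2 = 2 * (m + e - q u) + 2 * (m + e - q v) +
    4 * (q (2^-1 *: u + 2^-1 *: v) - m).
  rewrite -inner_norm /q linf // -[2^-1 *: v]addr0 linf // addr0.
  have -> : f 0 = 0.
    have := linf 1 U0 U0; rewrite scaler0 addr0 mul1r => /eqP.
    by rewrite eq_sym -subr_eq0 addrK => /eqP.
  have c2 : Num.conj (2^-1 : R[i]) = 2^-1.
    by apply/CrealP; rewrite ger0_real ?invr_ge0.
  rewrite innerBl !innerBr !innerDl !innerDr !innerZl !innerZr.
  rewrite !(conjD, conjM) c2; by field.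
by apply: ltr_wpDr; [exact: mulr_ge0|apply: addr_gt0; exact: mulr_gt0].
Qed.

(** The sublevel sets of [q] generate a Cauchy filter, whose limit represents [f]. As [U] may fail
    to be closed, the limit is only placed in its closure. *)
Lemma riesz_subspace :
  exists2 y, closure U y & forall x, U x -> f x = inner x y.
Proof.
have [m [em am]] := q_inf.
(* The tolerance [r^2 / 4] makes any two points of [B r] lie at distance less than [r]. *)
pose B (r : R) := [set x | U x /\ q x < m + r%:C ^+ 2 / 4].
have BS r s : 0 < r -> r <= s -> B r `<=` B s.
  move=> r0 rs x [Ux qx]; split=> //; apply: lt_le_trans qx _.
  rewrite lerD2l ler_pM2r ?invr_gt0 // -!rmorphXn lecR.
  by rewrite ler_pXn2r // nnegrE ltW // (lt_le_trans r0).
pose F := filter_from [set r : R | 0 < r] B.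
have FF : ProperFilter F.
  apply: filter_from_proper; last first.
    move=> r /= r0; have [|x Ux qx] := am (r%:C ^+ 2 / 4); last by exists x.
    by rewrite divr_gt0 // exprn_gt0 // ltcR.
  apply: filter_from_filter; first by exists 1 => /=.
  move=> r s /= r0 s0; exists (Num.min r s); first by rewrite /= lt_min r0.
  by move=> x Bx; split; apply: BS Bx; rewrite ?lt_min ?r0 // ge_min lexx ?orbT.
have BB r u v : 0 < r -> B r u -> B r v -> `|u - v| < r%:C.
  move=> r0 [Uu qu] [Uv qv].
  rewrite -(@ltr_pXn2r _ 2) ?nnegrE ?lecR ?(ltW r0) //.
  by have := q_cauchy em Uu Uv qu qv; rewrite mulrCA mulfV ?mulr1 ?pnatr_eq0.
have [y Fy] : exists y : H, F --> y.
  apply/cvg_ex; apply: cauchy_cvg; apply/cauchyP => e e0.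
  have /complex_realP[r er] := gtr0_real e0.
  have r0 : 0 < r by rewrite -ltcR -er.
  have [u Bu] : exists u, B r u by apply: (@filter_ex _ F); exists r.
  exists u; exists r => // v Bv; rewrite -ball_normE /= er; exact: BB Bv.
have yB r : 0 < r -> exists2 u, B r u & `|y - u| < r%:C.
  move=> r0; have Fr : F [set u | `|y - u| < r%:C].
    apply: Fy; have := nbhsx_ballx y r%:C; rewrite -ball_normE; apply.
    by rewrite ltcR.
  have [u [Bu yu]] : exists u, B r u /\ `|y - u| < r%:C.
    by apply: (@filter_ex _ F); apply: filterI => //; exists r.
  by exists u.
exists y.
  apply/closure_normP => e e0.
  have /complex_realP[r er] := gtr0_real e0.
  have [|u [Uu _] yu] := yB r; first by rewrite -ltcR -er.
  by exists u => //; rewrite er.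
move=> x Ux; apply/eqP; rewrite -subr_eq0; apply/eqP/eq0_le_pos => e e0.
(* Replacing [y] by a near-minimizer [u] costs [|x| * d], and the defect of [u] at [x] costs at most
   [d * (1 + |x|)]; together these are [e]. *)
pose d := e / (1 + `|x| + `|x|).
have k0 : 0 < 1 + `|x| + `|x| by rewrite -addrA ltr_pwDl // addr_ge0.
have d0 : 0 < d by rewrite divr_gt0.
have /complex_realP[r dr] := gtr0_real d0.
have [|u [Uu qu] yu] := yB r; first by rewrite -ltcR -dr.
have -> : f x - inner x y = (f x - inner x u) - inner x (y - u).
  by rewrite innerBr; ring.
apply: le_trans (ler_normB _ _) _.
have -> : e = d * (1 + `|x|) + `|x| * d by rewrite /d; field; rewrite gt_eqF.
apply: lerD; last first.
  by apply: le_trans (inner_le _ _) _; apply: ler_wpM2l => //; rewrite dr ltW.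
rewrite -(@ler_pXn2r _ 2) ?nnegrE //; last first.
  by rewrite mulr_ge0 ?addr_ge0 // ltW.
apply: le_trans (q_near em Uu Ux qu) _; rewrite -dr [(d * _) ^+ 2]exprMn.
apply: ler_pM.
- by rewrite divr_ge0 // exprn_ge0 // ltW.
- by rewrite addr_ge0 // exprn_ge0.
- by rewrite ler_pdivrMr // ler_peMr ?exprn_ge0 ?(ltW d0) // ler1n.
- rewrite sqrrD expr1n mul1r; rewrite -subr_ge0.
  by rewrite (_ : _ - _ = `|x| *+ 2) ?mulrn_wge0 //; ring.
Qed.
End Riesz.

(** * Linear maps, and norms tested on dense subspaces *)

Lemma linD (R : pzRingType) (H K : lmodType R) (T : H -> K) :
  linear T -> forall x y, T (x + y) = T x + T y.
Proof. by move=> lT x y; have := lT 1 x y; rewrite !scale1r. Qed.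

Lemma lin0 (R : pzRingType) (H K : lmodType R) (T : H -> K) :
  linear T -> T 0 = 0.
Proof.
move=> lT; have /eqP := linD lT 0 0.
by rewrite addr0 -subr_eq0 opprD addrA subrr add0r oppr_eq0 => /eqP.
Qed.

Lemma linZ (R : pzRingType) (H K : lmodType R) (T : H -> K) :
  linear T -> forall c x, T (c *: x) = c *: T x.
Proof. by move=> lT c x; have := lT c x 0; rewrite !addr0 lin0 // addr0. Qed.

Lemma linB (R : pzRingType) (H K : lmodType R) (T : H -> K) :
  linear T -> forall x y, T (x - y) = T x - T y.
Proof. by move=> lT x y; rewrite -scaleN1r linD // linZ // scaleN1r. Qed.

Lemma lin_sum (R : pzRingType) (H K : lmodType R) (T : H -> K) I (r : seq I)
    (F : I -> H) :
  linear T -> T (\sum_(i <- r) F i) = \sum_(i <- r) T (F i).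
Proof.
move=> lT; elim/big_rec2 : _ => [|i y z _ <-]; first exact: lin0.
exact: linD.
Qed.

(** Testing on [y] itself would give [|y|^2 <= M * |y|]; since [y] is only in the closure of [U], it
    is tested on nearby points of [U]. *)
Lemma inner_le_bound (R : realType) (H : hilbertType R) (U : set H) (y : H)
    (M : R[i]) :
  0 <= M -> closure U y -> (forall x, U x -> `|inner x y| <= M * `|x|) ->
  `|y| <= M.
Proof.
move=> M0 /closure_normP Uy yM.
have [->|y0] := eqVneq y 0; first by rewrite normr0.
have ny : 0 < `|y| by rewrite normr_gt0.
suff h : `|y| ^+ 2 - M * `|y| <= 0 by rewrite -(ler_pM2r ny) -subr_le0.
have yMr : `|y| ^+ 2 - M * `|y| \is Num.real.
  by rewrite realB // ger0_real // ?exprn_ge0 // mulr_ge0.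
rewrite real_leNgt ?real0 //; apply/negP => lt0.
(* Chosen so that the total error [e * (|y| + M)] is half of the supposed gap [|y|^2 - M * |y|]. *)
pose e := (`|y| ^+ 2 - M * `|y|) / (`|y| + M) / 2.
have yM0 : 0 < `|y| + M by rewrite ltr_pwDl.
have e0 : 0 < e by rewrite !divr_gt0.
have [u Uu yu] := Uy e e0.
have : `|y| ^+ 2 <= e * `|y| + M * (`|y| + e).
  rewrite -inner_norm -(ger0_norm (inner_ge0 y)).
  rewrite -[X in inner X _](subrK u) innerDl.
  apply: le_trans (ler_normD _ _) _; apply: lerD.
    by apply: le_trans (inner_le _ _) _; rewrite ler_wpM2r // ltW.
  apply: le_trans (yM _ Uu) _; rewrite ler_wpM2l //.
  rewrite -[u](subKr y) (le_trans (ler_normB _ _)) // lerD2l ltW //.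
rewrite -subr_ge0.
have -> : e * `|y| + M * (`|y| + e) - `|y| ^+ 2 =
    - ((`|y| ^+ 2 - M * `|y|) / 2) by rewrite /e; field; rewrite gt_eqF.
rewrite oppr_ge0 => /(lt_le_trans (divr_gt0 lt0 (ltr0n _ 2))).
by rewrite ltxx.
Qed.

(** * Bounded operators: adjoints, total sets and extension by density *)

Section Bounded.
Context {R : realType}.
Implicit Types H K L : hilbertType R.

Lemma bounded_op_lin H K (T : H -> K) : bounded_op T -> linear T.
Proof. by case. Qed.

Lemma bounded_opE H K (T : H -> K) : bounded_op T ->
  exists2 M : R[i], 0 <= M & forall x, `|T x| <= M * `|x|.
Proof.
case=> _ [M TM]; exists `|M| => // x; have Tx := TM x.
by rewrite -[`|x|]normr_id -normrM (ger0_norm (le_trans _ Tx)).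
Qed.

Lemma bounded_id H : bounded_op (@id H).
Proof. by split=> //; exists 1 => x; rewrite mul1r. Qed.

Lemma bounded_comp H K L (S : K -> L) (T : H -> K) :
  bounded_op S -> bounded_op T -> bounded_op (S \o T).
Proof.
move=> bS bT.
have [M M0 SM] := bounded_opE bS; have [N N0 TN] := bounded_opE bT.
split=> [c x y /=|]; first by rewrite (bounded_op_lin bT) (bounded_op_lin bS).
exists (M * N) => x /=; apply: le_trans (SM _) _.
by rewrite -mulrA; apply: ler_wpM2l.
Qed.

Lemma bounded_lin H K (c : R[i]) (S T : H -> K) :
  bounded_op S -> bounded_op T -> bounded_op (c *: S + T).
Proof.
move=> bS bT.
have [M M0 SM] := bounded_opE bS; have [N N0 TN] := bounded_opE bT.
split=> [d x y|].
  rewrite /= !fctE (bounded_op_lin bT) (bounded_op_lin bS).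
  by rewrite !scalerDr !scalerA [c * d]mulrC addrACA.
exists (`|c| * M + N) => x; rewrite fctE mulrDl.
apply: le_trans (ler_normD _ _) _; apply: lerD => //.
by rewrite normrZ -mulrA ler_wpM2l.
Qed.

Lemma riesz H (f : H -> R[i]) (M : R[i]) :
  (forall c x y, f (c *: x + y) = c * f x + f y) ->
  (forall x, `|f x| <= M * `|x|) -> exists y, forall x, f x = inner x y.
Proof.
move=> lf bf; have sT : is_subspace [set: H] by apply/is_subspaceP.
have [y _ fy] := @riesz_subspace _ _ setT f M sT
  (fun c x y _ _ => lf c x y) (fun x _ => bf x).
by exists y => x; apply: fy.
Qed.

Lemma adjoint_eq H K (T : H -> K) (S : K -> H) :
  (forall x y, inner (T x) y = inner x (S y)) -> adjoint T = S.
Proof.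
move=> TS; apply: xget_unique => // S' TS'.
by apply/funext => y; apply: inner_extr => x; rewrite -TS' TS.
Qed.

(** Existence of the adjoint: Riesz applied to [inner (T x) y] as a functional of [x], for each
    [y]. *)
Lemma inner_adjoint H K (T : H -> K) : bounded_op T ->
  forall x y, inner (T x) y = inner x (adjoint T y).
Proof.
move=> bT; have [M M0 TM] := bounded_opE bT.
rewrite /adjoint; apply: (@xgetPex _ (cst 0)
  [set T' | forall x y, inner (T x) y = inner x (T' y)]).
suff /choice[S TS] : forall y, exists z, forall x, inner (T x) y = inner x z.
  by exists S.
move=> y; apply: (riesz (M := M * `|y|)) => [c u v|x].
  by rewrite (bounded_op_lin bT) innerDl innerZl.
by apply: le_trans (inner_le _ _) _; rewrite mulrAC ler_wpM2r.
Qed.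

Lemma adjoint_inner H K (T : H -> K) : bounded_op T ->
  forall x y, inner (adjoint T x) y = inner x (T y).
Proof. by move=> bT x y; rewrite innerC -inner_adjoint // -innerC. Qed.

Lemma adjoint_bounded H K (T : H -> K) : bounded_op T -> bounded_op (adjoint T).
Proof.
move=> bT; have [M M0 TM] := bounded_opE bT; split=> [c x y|].
  apply: inner_extr => z; rewrite -inner_adjoint // !innerDr !innerZr.
  by rewrite !inner_adjoint.
(* One factor is cancelled from [|T' y|^2 = inner y (T (T' y)) <= |y| * M * |T' y|], where [T'] is
   the adjoint. *)
exists M => y; have [->|y0] := eqVneq (adjoint T y) 0.
  by rewrite normr0 mulr_ge0.
have ny : 0 < `|adjoint T y| by rewrite normr_gt0.
rewrite -(ler_pM2r ny) -expr2 -inner_norm adjoint_inner //.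
rewrite -[X in X <= _](ger0_norm (_ : 0 <= _)).
  apply: le_trans (inner_le _ _) _; rewrite [M * _]mulrC -mulrA.
  by rewrite ler_wpM2l.
by rewrite -adjoint_inner // inner_ge0.
Qed.

Lemma projection_opP H (P : H -> H) : bounded_op P ->
  projection_op P <->
  P \o P = P /\ forall x y, inner (P x) y = inner x (P y).
Proof.
move=> bP; split=> [[_ PP aP]|[PP sP]]; last by split=> //; apply: adjoint_eq.
by split=> // x y; rewrite inner_adjoint // aP.
Qed.

(** The difference of the two adjoints takes values orthogonal to [G]. Totality of [G] is stated by
    orthogonality, the form in which minimality is used throughout. *)
Lemma bounded_ext H K (G : set H) (S T : H -> K) :
  bounded_op S -> bounded_op T ->
  (forall v, (forall g, G g -> inner g v = 0) -> v = 0) ->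
  (forall g, G g -> S g = T g) -> S = T.
Proof.
move=> bS bT totG GST; apply/funext => x; apply: inner_extl => y.
rewrite !inner_adjoint //; congr (inner x _).
apply/eqP; rewrite -subr_eq0; apply/eqP/totG => g Gg.
by rewrite innerBr -!inner_adjoint // GST // subrr.
Qed.

(** The relation [G] is the graph of a densely defined bounded operator. Riesz on its domain first
    yields the would-be adjoint [w]; the extension is the adjoint of [w]. *)
Lemma bounded_extension H K (G : set (H * K)) (M : R[i]) :
  G (0, 0) ->
  (forall (c : R[i]) x z x' z', G (x, z) -> G (x', z') ->
     G (c *: x + x', c *: z + z')) ->
  0 <= M -> (forall x z, G (x, z) -> `|z| <= M * `|x|) ->
  (forall v, closure [set x | exists z, G (x, z)] v) ->
  exists2 T : H -> K, bounded_op T & forall x z, G (x, z) -> T x = z.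
Proof.
move=> G0 GP M0 GM dG; set U := [set x | _] in dG.
have subU : is_subspace U.
  apply/is_subspaceP; split=> [|c x y [z Gz] [w Gw]]; first by exists 0.
  by exists (c *: z + w); exact: GP.
(* The bound makes [G] single-valued: two values over [x] differ by a value over [0], of norm at
   most [M * 0]. *)
have Gfun x z z' : G (x, z) -> G (x, z') -> z = z'.
  move=> Gz /(GP (-1) _ _ _ _ Gz); rewrite !scaleN1r => /GM.
  rewrite addNr normr0 mulr0 normr_le0 addrC subr_eq0 => /eqP ->//.
have [g gG] : exists g, forall x, U x -> G (x, g x).
  suff /choice[g gG] : forall x, exists z, U x -> G (x, z) by exists g.
  move=> x; have [[z Gz]|nUx] := pselect (U x); first by exists z.
  by exists 0.
have gE x z : G (x, z) -> g x = z.
  by move=> Gz; exact: (Gfun _ _ _ (gG x (ex_intro _ z Gz)) Gz).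
have gM x y : U x -> `|inner (g x) y| <= M * `|y| * `|x|.
  move=> Ux; apply: le_trans (inner_le _ _) _.
  by rewrite mulrAC ler_wpM2r //; apply: GM; exact: gG.
have /choice[w gw] :
    forall y, exists w, forall x, U x -> inner (g x) y = inner x w.
  move=> y; have [||w _ gw] := @riesz_subspace _ _ U (fun x => inner (g x) y)
    (M * `|y|) subU.
  - move=> c x x' Ux Ux'; have -> := gE _ _ (GP c _ _ _ _ (gG _ Ux) (gG _ Ux')).
    by rewrite innerDl innerZl.
  - by move=> x; exact: gM.
  by exists w.
have totU v : (forall x, U x -> inner x v = 0) -> v = 0.
  move=> v0; apply/eqP; rewrite -normr_eq0 eq_le normr_ge0 andbT.
  by apply: inner_le_bound (dG v) _ => // x Ux; rewrite v0 // normr0 mul0r.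
have bw : bounded_op w.
  split=> [c y y'|].
    apply/eqP; rewrite -subr_eq0; apply/eqP/totU => x Ux.
    by rewrite innerBr innerDr innerZr -!gw // innerDr innerZr subrr.
  exists M => y; apply: inner_le_bound (dG _) _ => [|x Ux].
    by rewrite mulr_ge0.
  by rewrite -gw // gM.
exists (adjoint w); first exact: adjoint_bounded.
move=> x z Gxz; apply: inner_extl => y; rewrite adjoint_inner // -gw //.
  by rewrite (gE _ _ Gxz).
by exists z.
Qed.

End Bounded.

(** * Orthogonal projections and closed spans *)

Lemma cs_lin (R : realType) (H : hilbertType R) (U : closedSubspace H)
    (c : R[i]) x y : cs_set U x -> cs_set U y -> cs_set U (c *: x + y).
Proof. by have /is_subspaceP[_] := cs_subspace U; apply. Qed.

Section OrthProjection.
Context {R : realType} {H : hilbertType R} (U : closedSubspace H).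
Local Notation Q := (orth_projection U).

(** The projection of a vector is the Riesz representative on [U] of the inner product with it;
    closedness puts that representative in [U]. *)
Lemma orth_projectionP x :
  cs_set U (Q x) /\ forall y, cs_set U y -> inner (x - Q x) y = 0.
Proof.
have QP : exists Q' : H -> H, forall x, Q' x \in (U : set H) /\
    forall y, y \in (U : set H) -> inner (x - Q' x) y = 0.
  suff /choice[Q' Q'P] : forall x, exists z, z \in (U : set H) /\
      forall y, y \in (U : set H) -> inner (x - z) y = 0 by exists Q'.
  move=> z; have [||y Uy yE] := @riesz_subspace _ _ U (fun x => inner x z)
    `|z| (cs_subspace U).
  - by move=> c u v _ _; rewrite innerDl innerZl.
  - by move=> u _; rewrite mulrC inner_le.
  exists y; split=> [|u]; first by rewrite inE; apply: (cs_closed (c := U)).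
  rewrite inE => Uu; rewrite innerC innerBr yE // subrr; exact: rmorph0.
have [QU Q0] := xgetPex (cst 0) QP x; split; first by rewrite -inE.
by move=> y Uy; apply: Q0; rewrite inE.
Qed.

Lemma orth_projection_in x : cs_set U (Q x).
Proof. by have [] := orth_projectionP x. Qed.

Lemma orth_projection_perp x y : cs_set U y -> inner (x - Q x) y = 0.
Proof. by have [_] := orth_projectionP x; apply. Qed.

Lemma inner_orth_projection x y : cs_set U y -> inner (Q x) y = inner x y.
Proof.
by move=> Uy; apply/eqP; rewrite eq_sym -subr_eq0 -innerBl orth_projection_perp.
Qed.

Lemma orth_projection_eq x z : cs_set U z ->
  (forall y, cs_set U y -> inner z y = inner x y) -> Q x = z.
Proof.
move=> Uz zx; apply/eqP; rewrite -subr_eq0; apply/eqP/inner_eq0.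
have Uqz : cs_set U (Q x - z).
  by rewrite addrC -scaleN1r; apply: cs_lin => //; exact: orth_projection_in.
by rewrite innerBl zx // inner_orth_projection // subrr.
Qed.

Lemma orth_projection_id x : cs_set U x -> Q x = x.
Proof. by move=> Ux; apply: orth_projection_eq. Qed.

Lemma orth_projection_bounded : bounded_op Q.
Proof.
split=> [c x y|].
  apply: orth_projection_eq => [|z Uz].
    by apply: cs_lin; exact: orth_projection_in.
  by rewrite !innerDl !innerZl !inner_orth_projection.
exists 1 => x; rewrite mul1r; have [->|q0] := eqVneq (Q x) 0.
  by rewrite normr0.
have nq : 0 < `|Q x| by rewrite normr_gt0.
rewrite -(ler_pM2r nq) -expr2 -inner_norm -(ger0_norm (inner_ge0 (Q x))).
rewrite inner_orth_projection ?inner_le //; exact: orth_projection_in.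
Qed.

End OrthProjection.

(** The closed span is the double orthogonal complement of [G]. Forward, orthogonality to [v] passes
    to spans and limits; backward, [x] minus its projection is orthogonal to [G], hence to
    itself. *)
Lemma closed_spanP (R : realType) (H : hilbertType R) (G : set H) x :
  cs_set (closed_span G) x <->
  forall v, (forall g, G g -> inner g v = 0) -> inner x v = 0.
Proof.
have GU g : G g -> cs_set (closed_span G) g.
  by move=> Gg; apply: subset_closure => W [_ GW]; exact: GW.
split=> [Ux v Gv|xG].
  have sv : is_subspace [set y | inner y v = 0].
    apply/is_subspaceP; split=> [|c y z /= yv zv]; first exact: inner0l.
    by rewrite innerDl innerZl yv zv mulr0 addr0.
  have cv u : span G u -> inner u v = 0.
    by move=> su; apply: (su [set y | inner y v = 0]); split.
  apply: eq0_le_pos => e e0.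
  have v1 : 0 < 1 + `|v| by rewrite ltr_pwDl.
  have d0 : 0 < e / (1 + `|v|) by exact: divr_gt0.
  have /closure_normP/(_ _ d0)[u su xu] := Ux.
  rewrite -[x](subrK u) innerDl (cv u su) addr0.
  apply: le_trans (inner_le _ _) _.
  apply: le_trans (ler_wpM2r _ (ltW xu)) _ => //.
  by rewrite mulrAC ler_pdivrMr // ler_wpM2l ?(ltW e0) // lerDr.
set U := closed_span G in GU *.
have Qx := orth_projection_in U x.
suff -> : x = orth_projection U x by [].
apply/eqP; rewrite -subr_eq0; apply/eqP/inner_eq0.
have Q0 g : cs_set U g -> inner g (x - orth_projection U x) = 0.
  by move=> Ug; rewrite innerC orth_projection_perp //; exact: rmorph0.
by rewrite innerBl (Q0 _ Qx) xG ?subrr // => g Gg; rewrite Q0 //; exact: GU.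
Qed.

(** * Representations of C*-algebras and their commutants *)

Section Representation.
Context {R : realType} {A : cstarType R} {K : hilbertType R}.
Variable sigma : A -> K -> K.
Hypothesis sr : star_representation sigma.
Implicit Types (D E : K -> K).

Lemma rep_bounded a : bounded_op (sigma a).
Proof. by have [_ + _ _ _] := sr; exact. Qed.

Lemma rep_linear a : linear (sigma a).
Proof. exact: bounded_op_lin (rep_bounded a). Qed.

Lemma repP (c : R[i]) a b x :
  sigma (c *: a + b) x = c *: sigma a x + sigma b x.
Proof. by have [ls _ _ _ _] := sr; rewrite ls. Qed.

Lemma rep_sum I (r : seq I) (F : I -> A) x :
  sigma (\sum_(i <- r) F i) x = \sum_(i <- r) sigma (F i) x.
Proof. by have [ls _ _ _ _] := sr; rewrite (lin_sum r F ls) fct_sumE. Qed.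

Lemma rep1 x : sigma 1 x = x.
Proof. by have [_ _ -> _ _] := sr. Qed.

Lemma repM a b x : sigma (a * b) x = sigma a (sigma b x).
Proof. by have [_ _ _ -> _] := sr. Qed.

Lemma inner_rep a x y : inner (sigma a x) y = inner x (sigma (star a) y).
Proof.
by have [_ _ _ _ ->] := sr; rewrite inner_adjoint //; exact: rep_bounded.
Qed.

Lemma commutantE D a x : commutant sigma D -> D (sigma a x) = sigma a (D x).
Proof. by case=> _ /(_ a) /(congr1 (@^~ x)). Qed.

Lemma commutant_id : commutant sigma id.
Proof. by split=> //; exact: bounded_id. Qed.

Lemma commutant_lin (c : R[i]) D E :
  commutant sigma D -> commutant sigma E -> commutant sigma (c *: D + E).
Proof.
move=> cD cE; split=> [|a].
  by apply: bounded_lin; [case: cD|case: cE].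
apply/funext => x /=; rewrite !fctE /= (commutantE _ _ cD) (commutantE _ _ cE).
by rewrite (linD (rep_linear a)) (linZ (rep_linear a)).
Qed.

(** The entry [(j, i)] of the matrix is the sum over [k] of [star (X k j) * X k i]. The starred
    factor moves to the right of the inner product, and [D] and [E] commute with [sigma]. *)
Lemma rep_gram n (X : 'M[A]_n) (xi : 'I_n -> K) D E :
  commutant sigma D -> commutant sigma E ->
  \sum_(j < n) inner (\sum_(i < n)
      sigma (((map_mx star X)^T *m X) j i) (D (xi i))) (E (xi j)) =
  \sum_(k < n) inner (D (\sum_(i < n) sigma (X k i) (xi i)))
                     (E (\sum_(i < n) sigma (X k i) (xi i))).
Proof.
move=> cD cE; have lD : linear D by case: cD => /bounded_op_lin.
have lE : linear E by case: cE => /bounded_op_lin.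
under [RHS]eq_bigr => k _.
  rewrite (lin_sum _ _ lD) (lin_sum _ _ lE) inner_sumr; under eq_bigr => j _.
    rewrite inner_suml; over.
  over.
rewrite exchange_big; apply: eq_bigr => j _ /=.
rewrite exchange_big inner_suml; apply: eq_bigr => i _ /=.
rewrite mxE rep_sum inner_suml; apply: eq_bigr => k _.
by rewrite !mxE repM inner_rep starK (commutantE _ _ cD) (commutantE _ _ cE).
Qed.

End Representation.

(** * Stinespring representations, Radon-Nikodym derivatives and submaps *)

Section Stinespring.
Context {R : realType} {A : cstarType R} {H K : hilbertType R}.
Variables (Psi : A -> H -> H) (sigma : A -> K -> K) (T : H -> K).
Implicit Types (D E : K -> K).

Lemma inner_stinespring : stinespring Psi sigma T ->
  forall a x y, inner (Psi a x) y = inner (sigma a (T x)) (T y).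
Proof. by move=> [_ bT PsiE] a x y; rewrite PsiE /= adjoint_inner. Qed.

Lemma minimal_stinespring_total : minimal_stinespring Psi sigma T ->
  forall v, (forall a x, inner (sigma a (T x)) v = 0) -> v = 0.
Proof.
move=> [_ dT] v v0; apply: inner_eq0.
have /closed_spanP : cs_set (closed_span
    [set sigma a (T xi) | a in setT & xi in setT]) v by rewrite /= dT.
by apply=> _ [a _ [x _ <-]].
Qed.

Hypothesis sr : star_representation sigma.
Hypothesis bT : bounded_op T.

Lemma inner_submap D a x y :
  inner (submap sigma T D a x) y = inner (sigma a (D (T x))) (T y).
Proof. by rewrite /submap /= adjoint_inner. Qed.

(** Uniqueness: the matrix coefficients of a derivative between the total vectors [sigma a (T x)]
    are determined by the values of [Phi] at the elements [star b * a]. *)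
Lemma radon_nikodymE (Phi : A -> H -> H) E :
  (forall v, (forall a x, inner (sigma a (T x)) v = 0) -> v = 0) ->
  positive_op E -> commutant sigma E ->
  (forall a x y, inner (Phi a x) y = inner (sigma a (E (T x))) (T y)) ->
  radon_nikodym sigma T Phi = E.
Proof.
move=> totT pE cE PhiE; apply: xget_unique.
  split=> // a; apply/funext => x; apply: inner_extl => y.
  by rewrite PhiE -inner_submap.
move=> F [pF cF PhiF].
apply: (bounded_ext (G := [set sigma a (T x) | a in setT & x in setT])).
- by case: cF.
- by case: cE.
- by move=> v v0; apply: totT => a x; apply: v0; exists a => //; exists x.
- move=> _ [a _ [x _ <-]]; apply/eqP; rewrite -subr_eq0; apply/eqP/totT => b y.
  rewrite innerBr.
  have FE G : commutant sigma G -> inner (sigma b (T y)) (G (sigma a (T x))) =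
      Num.conj (inner (sigma (star b * a) (G (T x))) (T y)).
    move=> cG; rewrite (commutantE _ _ cG) innerC repM //.
    by rewrite [X in _ = Num.conj X]inner_rep // starK.
  by rewrite !FE // -inner_submap -PhiE PhiF subrr.
Qed.

(** By [rep_gram] with [E = id], the form to be bounded is a sum of terms [inner (D y) y]. *)
Lemma submap_cp D : commutant sigma D -> positive_op D ->
  completely_positive_op (submap sigma T D).
Proof.
move=> cD [bD D0]; split=> [c a b|a|n M [X ->] xi].
- apply/funext => x; apply: inner_extl => y.
  rewrite !fctE innerDl innerZl !inner_submap repP //.
  by rewrite innerDl innerZl.
- do 3 apply: bounded_comp => //; first exact: adjoint_bounded.
  exact: rep_bounded.
- have := rep_gram sr X (T \o xi) cD (commutant_id sigma) => /=.
  under eq_bigr do rewrite inner_suml.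
  under [X in _ -> 0 <= X]eq_bigr => i _.
    rewrite inner_suml; under eq_bigr do rewrite inner_submap.
    over.
  by move=> ->; apply: sumr_ge0.
Qed.

End Stinespring.

Lemma projection_positive (R : realType) (H : hilbertType R) (P : H -> H) :
  projection_op P -> positive_op P.
Proof.
move=> pP; have [bP PP _] := pP; split=> // x.
have [_ sP] := (projection_opP bP).1 pP.
by rewrite -PP /= sP inner_ge0.
Qed.

Lemma submap_comp_cp (R : realType) (A B : cstarType R) (H : hilbertType R)
    (Lambda : A -> B) (Psi : B -> H -> H) :
  completely_positive Lambda -> completely_positive_op Psi ->
  completely_positive_op (Psi \o Lambda).
Proof.
move=> [lL pL] [lP bP pP]; split=> [c a b|a|n M pM xi].
- by rewrite /= lL lP.
- exact: bP.
- have /pP/(_ xi) := pL _ _ pM.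
  by under eq_bigr do under eq_bigr do rewrite mxE.
Qed.

(** * The lift from the commutant of [pi] to the commutant of [phi] *)

Section Lift.
Context {R : realType} {A B : cstarType R} {K L : hilbertType R}.
Variables (Lambda : A -> B) (pi : B -> K -> K) (phi : A -> L -> L) (S : K -> L).
Hypothesis cpL : completely_positive Lambda.
Hypothesis spi : star_representation pi.
Hypothesis mphi : minimal_stinespring (pi \o Lambda) phi S.
Implicit Types D E : K -> K.

Let sphi : star_representation phi. Proof. by case: mphi => -[]. Qed.
Let bS : bounded_op S. Proof. by case: mphi => -[]. Qed.

(** A list of pairs encodes both a vector (for [D = id]) and its intended image under the lift of
    [D], so the lift can be handled as a graph before it is known to be well defined. *)
Let lift_sum (D : K -> K) (s : seq (A * K)) : L :=
  \sum_(p <- s) phi p.1 (S (D p.2)).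

Lemma inner_lift a b x y :
  inner (phi b (S x)) (phi a (S y)) = inner (pi (Lambda (star a * b)) x) y.
Proof.
case: mphi => /inner_stinespring PsiE _.
by rewrite innerC inner_rep // -innerC -repM // -PsiE.
Qed.

(* The [y k] are the vectors y_k of the header. They do not depend on [D] and
   [E], and [positive_mx] provides the factor X without functional calculus. *)
Let lift_gram (s : seq (A * K)) : exists n (y : 'I_n -> K), forall D E,
  commutant pi D -> commutant pi E ->
  inner (lift_sum D s) (lift_sum E s) = \sum_(k < n) inner (D (y k)) (E (y k)).
Proof.
pose a (i : 'I_(size s)) := (tnth (in_tuple s) i).1.
pose eta (i : 'I_(size s)) := (tnth (in_tuple s) i).2.
(* The [a i] fill row 0 and the other rows vanish: a square factor, as [positive_mx] demands, of the
   matrix with entries [star (a i) * a j]. *)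
pose Y : 'M[A]_(size s) := \matrix_(k, i) if val k == 0%N then a i else 0.
have YE i j : ((map_mx star Y)^T *m Y) i j = star (a i) * a j.
  (* Only row 0 contributes; the index 0 exists because [i] lies below [size s]. *)
  rewrite mxE (bigD1 (Ordinal (leq_ltn_trans (leq0n i) (ltn_ord i)))) //=.
  rewrite !mxE /= big1 ?addr0 // => k k0; rewrite !mxE.
  by case: ifPn => [/eqP kz|_]; [case/eqP: k0; exact/val_inj|rewrite mulr0].
have [X XE] : positive_mx (map_mx Lambda ((map_mx star Y)^T *m Y)).
  by have [_] := cpL; apply; exists Y.
exists (size s), (fun k => \sum_i pi (X k i) (eta i)) => D E cD cE.
have sE F : lift_sum F s = \sum_i phi (a i) (S (F (eta i))).
  by rewrite /lift_sum big_tnth.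
rewrite -(rep_gram spi X eta cD cE) !sE inner_sumr.
apply: eq_bigr => j _; rewrite !inner_suml; apply: eq_bigr => i _.
by rewrite inner_lift -XE mxE YE.
Qed.

(** Linear combinations are realized on lists by concatenation, the scalar being absorbed in the
    algebra component; this makes the graph of the lift a subspace. *)
Let lift_sumP (D : K -> K) (c : R[i]) s t :
  lift_sum D ([seq (c *: p.1, p.2) | p <- s] ++ t) =
  c *: lift_sum D s + lift_sum D t.
Proof.
rewrite /lift_sum big_cat big_map scaler_sumr; congr (_ + _).
apply: eq_bigr => p _ /=; rewrite -[c *: p.1]addr0 repP //.
suff -> : phi 0 (S (D p.2)) = 0 by rewrite addr0.
have [lphi _ _ _ _] := sphi; by rewrite (lin0 lphi).
Qed.

Let dense_sums v : closure [set x | exists s, x = lift_sum id s] v.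
Proof.
have [_ dphi] := mphi; have : [set: L] v by [].
rewrite -dphi; apply: closureS => x; apply; split; last first.
  by move=> _ [a _ [eta _ <-]]; exists [:: (a, eta)];
    rewrite /lift_sum big_seq1.
apply/is_subspaceP; split; first by exists [::]; rewrite /lift_sum big_nil.
move=> c _ _ [s ->] [t ->].
exists ([seq (c *: p.1, p.2) | p <- s] ++ t).
by rewrite -lift_sumP //; exact: commutant_id.
Qed.

Lemma lift_opP D : commutant pi D -> commutant phi (lift_op phi S D) /\
  forall a eta, lift_op phi S D (phi a (S eta)) = phi a (S (D eta)).
Proof.
move=> cD; have [bD _] := cD; have [M M0 DM] := bounded_opE bD.
suff ex : exists G, commutant phi G /\
    forall a eta, G (phi a (S eta)) = phi a (S (D eta)).
  exact: (xgetPex (cst 0) ex).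
pose G := [set p | exists s, p = (lift_sum id s, lift_sum D s)].
have [||||G' bG' G'E] := @bounded_extension _ L L G M _ _ M0 _ _.
- by exists [::]; rewrite /lift_sum !big_nil.
- move=> c x z x' z' [s [-> ->]] [t [-> ->]].
  exists ([seq (c *: p.1, p.2) | p <- s] ++ t).
  by rewrite !lift_sumP //; exact: commutant_id.
- move=> x z [s [-> ->]].
  (* The same vectors [y k] compute both norms, so the bound [M] for [D] applies term by term and is
     inherited by the lift. *)
  have [n [y yE]] := lift_gram s.
  rewrite -(@ler_pXn2r _ 2) ?nnegrE ?mulr_ge0 // exprMn -!inner_norm !yE //;
    try exact: commutant_id.
  rewrite mulr_sumr; apply: ler_sum => k _; rewrite !inner_norm -exprMn.
  by rewrite ler_pXn2r ?nnegrE ?mulr_ge0.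
- move=> v; apply: closureS (@dense_sums v) => _ [s ->].
  by exists (lift_sum D s), s.
have G'g a eta : G' (phi a (S eta)) = phi a (S (D eta)).
  by apply: G'E; exists [:: (a, eta)]; rewrite /lift_sum !big_seq1.
exists G'; split=> //; split=> // b.
(* Commutation with [phi b] is checked on the total vectors [phi a (S x)], where both sides give
   [phi (b * a) (S (D x))]. *)
apply: (bounded_ext (G := [set phi a (S x) | a in setT & x in setT])).
- by apply: bounded_comp => //; exact: rep_bounded.
- by apply: bounded_comp => //; exact: rep_bounded.
- move=> v v0; apply: (minimal_stinespring_total mphi) => a x.
  by apply: v0; exists a => //; exists x.
- by move=> _ [a _ [x _ <-]]; rewrite /= -repM // !G'g repM.
Qed.

Lemma lift_commutant D : commutant pi D -> commutant phi (lift_op phi S D).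
Proof. by move=> /lift_opP[]. Qed.

Lemma lift_bounded D : commutant pi D -> bounded_op (lift_op phi S D).
Proof. by move=> /lift_commutant[]. Qed.

Lemma lift_opE D a x : commutant pi D ->
  lift_op phi S D (phi a (S x)) = phi a (S (D x)).
Proof. by move=> /lift_opP[_]; exact. Qed.

(** Reduces every identity for the lift (linearity, idempotence, selfadjointness) to a check on
    generators. *)
Lemma lift_op_uniq D G : commutant pi D -> bounded_op G ->
  (forall a x, G (phi a (S x)) = phi a (S (D x))) -> lift_op phi S D = G.
Proof.
move=> cD bG GE.
apply: (bounded_ext (G := [set phi a (S x) | a in setT & x in setT])) => //.
- exact: lift_bounded.
- move=> v v0; apply: (minimal_stinespring_total mphi) => a x.
  by apply: v0; exists a => //; exists x.
- by move=> _ [a _ [x _ <-]]; rewrite lift_opE.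
Qed.

Lemma lift_op_lin (c : R[i]) D E : commutant pi D -> commutant pi E ->
  lift_op phi S (c *: D + E) = c *: lift_op phi S D + lift_op phi S E.
Proof.
move=> cD cE; apply: lift_op_uniq; first exact: commutant_lin.
  by apply: bounded_lin; exact: lift_bounded.
move=> a x; rewrite !fctE !lift_opE // (linD (bounded_op_lin bS)).
rewrite (linZ (bounded_op_lin bS)) (linD (rep_linear sphi a)).
by rewrite (linZ (rep_linear sphi a)).
Qed.

(** On the dense sums, positivity is the Gram identity with [E = id]; it extends to all [x] by
    continuity of the quadratic form. *)
Lemma lift_op_positive D x : commutant pi D -> positive_op D ->
  0 <= inner (lift_op phi S D x) x.
Proof.
move=> cD [bD D0]; set G := lift_op phi S D.
have [M M0 GM] := bounded_opE (lift_bounded cD).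
have G0 s : 0 <= inner (G (lift_sum id s)) (lift_sum id s).
  have -> : G (lift_sum id s) = lift_sum D s.
    rewrite /G /lift_sum (lin_sum _ _ (bounded_op_lin (lift_bounded cD))).
    by apply: eq_bigr => p _; rewrite lift_opE.
  have [n [y yE]] := lift_gram s.
  by rewrite yE //; [exact: sumr_ge0|exact: commutant_id].
(* Nonnegativity in [R[i]] includes being real, so it is proved as the equation [|z| = z], which
   passes to limits. *)
suff /eqP : `|inner (G x) x| - inner (G x) x = 0.
  by rewrite subr_eq0 => /eqP <-.
apply: eq0_le_pos => e e0.
(* The distance [e / (C + e)] is at most 1, whence [|u| <= |x| + 1], and is defined even if [C = 0].
   The factor 2 pays for the two differences [|z| - |w|] and [z - w]. *)
pose C := (M * `|x| + M * (`|x| + 1)) *+ 2.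
have C0 : 0 <= C by rewrite mulrn_wge0 // addr_ge0 // mulr_ge0 ?addr_ge0.
have Ce : 0 < C + e by rewrite ltr_wpDl.
have d0 : 0 < e / (C + e) by exact: divr_gt0.
have [_ [s ->] xu] := (closure_normP _ _).1 (@dense_sums x) _ d0.
have := G0 s; set u := lift_sum id s in xu * => Gu.
have zw : `|inner (G x) x - inner (G u) u| <=
    e / (C + e) * (M * `|x| + M * (`|x| + 1)).
  have -> : inner (G x) x - inner (G u) u =
      inner (G (x - u)) x + inner (G u) (x - u).
    rewrite /G (linB (bounded_op_lin (lift_bounded cD))) innerBl innerBr.
    ring.
  apply: le_trans (ler_normD _ _) _; rewrite mulrDr; apply: lerD.
    apply: le_trans (inner_le _ _) _; rewrite mulrA [_ * M]mulrC.
    rewrite ler_wpM2r //; apply: le_trans (GM _) _.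
    by rewrite ler_wpM2l // ltW.
  apply: le_trans (inner_le _ _) _; rewrite mulrC.
  apply: ler_pM => //; first exact: ltW.
  apply: le_trans (GM _) _; rewrite ler_wpM2l // -[u](subKr x).
  apply: le_trans (ler_normB _ _) _; rewrite lerD2l (le_trans (ltW xu)) //.
  by rewrite ler_pdivrMr // mul1r lerDr.
set z := inner (G x) x in zw *; set w := inner (G u) u in Gu zw.
have -> : `|z| - z = (`|z| - `|w|) - (z - w) by rewrite (ger0_norm Gu); ring.
apply: le_trans (ler_normB _ _) _.
apply: le_trans (lerD (ler_dist_dist _ _) (lexx _)) _.
rewrite -mulr2n; apply: le_trans (_ : _ <= e / (C + e) * C) _.
  by rewrite mulrnAr lerMn2r.
by rewrite mulrAC ler_pdivrMr // ler_wpM2l ?(ltW e0) // lerDl ltW.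
Qed.

Lemma lift_op_projection P : commutant pi P -> projection_op P ->
  projection_op (lift_op phi S P).
Proof.
move=> cP pP; have [bP PP _] := pP; have [_ sP] := (projection_opP bP).1 pP.
have bG := lift_bounded cP; apply/projection_opP => //; split.
  apply/esym/lift_op_uniq => //; first exact: bounded_comp.
  by move=> a x /=; rewrite !lift_opE // -[P (P x)]/((P \o P) x) PP.
(* Selfadjointness follows by uniqueness once the adjoint acts as the lift on generators; there
   [inner_lift] turns the claim into [P] being selfadjoint and commuting with [pi]. *)
suff GE : lift_op phi S P = adjoint (lift_op phi S P).
  by move=> x y; rewrite inner_adjoint // -GE.
apply: lift_op_uniq => //; first exact: adjoint_bounded.
move=> a x; apply/eqP; rewrite -subr_eq0; apply/eqP.
apply: (minimal_stinespring_total mphi) => b y.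
rewrite innerBr -inner_adjoint // lift_opE // !inner_lift -commutantE // sP.
exact: subrr.
Qed.

End Lift.

(** * Compressions of operators to a closed subspace *)

Section Compression.
Context {R : realType} {L : hilbertType R} (U : closedSubspace L).
Local Notation Q := (orth_projection U).
Implicit Types (G : L -> L) (u v : cs_type U).

Lemma inner_val u v : inner u v = inner (val u) (val v).
Proof. by []. Qed.

Lemma norm_val u : `|u| = `|val u|.
Proof. by []. Qed.

Lemma valPlin (c : R[i]) u v : val (c *: u + v) = c *: val u + val v.
Proof. by []. Qed.

Lemma valU u : cs_set U (val u).
Proof. by have := valP u; rewrite inE. Qed.

Lemma val_insubdU x : cs_set U x -> val (insubd (0 : cs_type U) x) = x.
Proof. by move=> Ux; rewrite insubdK // inE. Qed.

(** The default [0] is never taken, because [Q] has values in [U]. *)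
Definition compression G : cs_type U -> cs_type U :=
  fun u => insubd 0 (Q (G (val u))).

Lemma val_compression G u : val (compression G u) = Q (G (val u)).
Proof. by rewrite val_insubdU //; exact: orth_projection_in. Qed.

Lemma compression_bounded G : bounded_op G -> bounded_op (compression G).
Proof.
move=> bG; have bQG := bounded_comp (orth_projection_bounded U) bG.
have [M M0 QGM] := bounded_opE bQG; split=> [c u v|].
  apply: val_inj; rewrite valPlin !val_compression valPlin.
  exact: (bounded_op_lin bQG).
by exists M => u; rewrite !norm_val val_compression; exact: QGM.
Qed.

Lemma inner_compression G u v :
  inner (compression G u) v = inner (G (val u)) (val v).
Proof.
by rewrite inner_val val_compression inner_orth_projection //; exact: valU.
Qed.

Variable G : L -> L.
Hypothesis pG : projection_op G.

Let bG : bounded_op G. Proof. by case: pG. Qed.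

Let GG x : G (G x) = G x.
Proof. by have [_ GGE _] := pG; rewrite -{3}GGE. Qed.

Let sG x y : inner (G x) y = inner x (G y).
Proof. by have [_] := (projection_opP bG).1 pG. Qed.

Lemma compression_projectionP :
  projection_op (compression G) <-> forall x, cs_set U x -> cs_set U (G x).
Proof.
have bC := compression_bounded bG.
split=> [/(projection_opP bC)[CC _] x Ux|GU].
  have QGx : Q (G (Q (G x))) = Q (G x).
    have /(congr1 (fun C => val (C (insubd 0 x)))) := CC.
    by rewrite /= !val_compression val_insubdU.
  suff -> : G x = Q (G x) by exact: orth_projection_in.
  have UQ y : cs_set U (Q y) := orth_projection_in U y.
  (* As [G] is selfadjoint and [x] lies in [U], the left side is the conjugate of
     [inner (Q (G (Q (G x)))) x], and idempotence shortens this to [inner (G x) x]. *)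
  have QQ : inner (Q (G x)) (Q (G x)) = inner (G x) (G x).
    rewrite inner_orth_projection // sG innerC.
    rewrite -(inner_orth_projection _ Ux) QGx.
    by rewrite (inner_orth_projection _ Ux) -[G x in LHS]GG sG -innerC.
  (* Pythagoras: the squared norm of [G x - Q (G x)] is the difference of the two squared norms just
     shown equal. *)
  apply/eqP; rewrite -subr_eq0; apply/eqP/inner_eq0.
  rewrite innerBr (orth_projection_perp _ (orth_projection_in U _)) subr0.
  rewrite innerBl -QQ.
  rewrite [X in _ - X]innerC.
  rewrite -(inner_orth_projection (G x) (orth_projection_in U (G x))).
  by rewrite -innerC subrr.
apply/projection_opP => //; split=> [|u v].
  apply/funext => u; apply: val_inj; rewrite /= !val_compression.
  have UGu := GU _ (valU u).
  by rewrite (orth_projection_id UGu) GG orth_projection_id.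
by rewrite inner_compression sG innerC -inner_compression -innerC.
Qed.

(** Invariance of [U] suffices: for [y] in [U], selfadjointness moves [G] onto [y], and [G y] still
    lies in [U], where [Q] is invisible. *)
Lemma orth_projection_commuteP :
  G \o Q = Q \o G <-> forall x, cs_set U x -> cs_set U (G x).
Proof.
split=> [GQ x Ux|GU].
  rewrite -[x](orth_projection_id Ux) -[G _]/((G \o Q) x) GQ.
  exact: orth_projection_in.
apply/funext => x /=; apply/esym/orth_projection_eq => [|y Uy].
  by apply: GU; exact: orth_projection_in.
by rewrite !sG inner_orth_projection //; exact: GU.
Qed.

Lemma reduces_projectionP :
  reduces G U <-> forall x, cs_set U x -> cs_set U (G x).
Proof.
split=> [[]//|GU]; split=> // x xU y Uy.
by rewrite sG; apply: xU; exact: GU.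
Qed.

End Compression.

Arguments compression {R L} U G u.

(** * The pulled-back representation and the transfer map *)

Section Pullback.
Context {R : realType} {A B : cstarType R} {H K L : hilbertType R}.
Variables (Lambda : A -> B) (pi : B -> K -> K) (V : H -> K).
Variables (phi : A -> L -> L) (S : K -> L).
Hypothesis cpL : completely_positive Lambda.
Hypothesis spi : star_representation pi.
Hypothesis bV : bounded_op V.
Hypothesis mphi : minimal_stinespring (pi \o Lambda) phi S.

Let sphi : star_representation phi. Proof. by case: mphi => -[]. Qed.
Let bS : bounded_op S. Proof. by case: mphi => -[]. Qed.

Local Notation U := (pullback_space V phi S).
Local Notation rho := (pullback_rep V phi S).
Local Notation W := (pullback_op V phi S).
Local Notation Q := (orth_projection U).

Lemma pullback_spaceP x : cs_set U x <->
  forall v, (forall a xi, inner (phi a (S (V xi))) v = 0) -> inner x v = 0.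
Proof.
split=> [/closed_spanP Ux v v0|Ux].
  by apply: Ux => _ [a _ [xi _ <-]].
apply/closed_spanP => v v0; apply: Ux => a xi; apply: v0.
by exists a => //; exists xi.
Qed.

Lemma pullback_space_gen a xi : cs_set U (phi a (S (V xi))).
Proof. by apply/pullback_spaceP => v ->. Qed.

Lemma pullback_space_inv a x : cs_set U x -> cs_set U (phi a x).
Proof.
move=> /pullback_spaceP Ux; apply/pullback_spaceP => v v0.
rewrite inner_rep //; apply: Ux => b xi.
by rewrite -[a]starK -inner_rep // -repM.
Qed.

(** [U] is invariant under [phi a] and [phi (star a)], so its projection commutes with [phi a]. *)
Lemma orth_projection_rep a x : Q (phi a x) = phi a (Q x).
Proof.
apply: orth_projection_eq => [|y Uy].
  by apply: pullback_space_inv; exact: orth_projection_in.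
rewrite !(inner_rep sphi) inner_orth_projection //.
exact: pullback_space_inv.
Qed.

Lemma val_pullback_rep a u : val (rho a u) = phi a (val u).
Proof. by rewrite val_insubdU //; apply: pullback_space_inv; exact: valU. Qed.

Lemma val_pullback_op xi : val (W xi) = S (V xi).
Proof.
by rewrite val_insubdU // -[S _](rep1 sphi); exact: pullback_space_gen.
Qed.

Lemma pullback_rep_bounded a : bounded_op (rho a).
Proof.
have bphi := rep_bounded sphi a; have [M M0 phiM] := bounded_opE bphi.
split=> [c u v|].
  apply: val_inj; rewrite valPlin !val_pullback_rep valPlin.
  exact: (bounded_op_lin bphi).
by exists M => u; rewrite !norm_val val_pullback_rep; exact: phiM.
Qed.

Lemma pullback_rep_star : star_representation rho.
Proof.
split=> [c a b|||a b|a].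
- apply/funext => u; apply: val_inj; rewrite !fctE valPlin !val_pullback_rep.
  by rewrite repP.
- exact: pullback_rep_bounded.
- by apply/funext => u; apply: val_inj; rewrite val_pullback_rep rep1.
- by apply/funext => u; apply: val_inj; rewrite /= !val_pullback_rep repM.
- apply/esym/adjoint_eq => u v.
  by rewrite !inner_val !val_pullback_rep inner_rep.
Qed.

Lemma pullback_op_bounded : bounded_op W.
Proof.
have bSV := bounded_comp bS bV; have [M M0 SVM] := bounded_opE bSV.
split=> [c x y|].
  apply: val_inj; rewrite valPlin !val_pullback_op.
  exact: (bounded_op_lin bSV).
by exists M => x; rewrite norm_val val_pullback_op; exact: SVM.
Qed.

(** Minimality of [(rho, U, W)], in orthogonality form. *)
Lemma pullback_total v : (forall a xi, inner (rho a (W xi)) v = 0) -> v = 0.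
Proof.
move=> v0; apply: inner_eq0; rewrite inner_val.
apply: ((pullback_spaceP (val v)).1 (valU v)) => a xi.
by rewrite -val_pullback_op -val_pullback_rep -inner_val.
Qed.

Lemma compression_commutant G : commutant phi G ->
  commutant rho (compression U G).
Proof.
move=> cG; split=> [|a]; first by apply: compression_bounded; case: cG.
apply/funext => u; apply: val_inj; rewrite /= val_pullback_rep.
rewrite !val_compression val_pullback_rep.
by rewrite (commutantE _ _ cG) orth_projection_rep.
Qed.

Lemma compression_positive G : bounded_op G ->
  (forall x, 0 <= inner (G x) x) -> positive_op (compression U G).
Proof.
move=> bG G0; split=> [|u]; first exact: compression_bounded.
by rewrite inner_compression.
Qed.

(** The lift carries [S (V x)] to [S (D (V x))], so its compression reproduces
    [submap pi V D \o Lambda] in the representation [rho]. *)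
Lemma radon_nikodym_pullback D : commutant pi D -> positive_op D ->
  radon_nikodym rho W (submap pi V D \o Lambda) =
  compression U (lift_op phi S D).
Proof.
move=> cD pD.
apply: (radon_nikodymE pullback_rep_star pullback_op_bounded pullback_total).
- apply: compression_positive => [|x]; first exact: (lift_bounded cpL spi mphi).
  exact: (lift_op_positive cpL spi mphi).
- by apply: compression_commutant; exact: (lift_commutant cpL spi mphi).
- move=> a x y /=; rewrite inner_submap // inner_val val_pullback_rep.
  rewrite val_compression -orth_projection_rep !val_pullback_op.
  rewrite inner_orth_projection; last first.
    by rewrite -[S _](rep1 sphi); exact: pullback_space_gen.
  (* [S (V x)] is written as [phi 1 (S (V x))], a generator on which the lift is known. *)
  rewrite -[S (V x)](rep1 sphi) (lift_opE cpL spi mphi _ _ cD) rep1 //.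
  by have [/inner_stinespring <-] := mphi.
Qed.

(** Compression of the lift is a linear map with the prescribed values, so a transfer map exists;
    whichever one is selected has the Radon-Nikodym value at positive [D]. *)
Lemma transfer_mapE D : commutant pi D -> positive_op D ->
  transfer_map Lambda pi V phi S D = compression U (lift_op phi S D).
Proof.
move=> cD pD; rewrite -radon_nikodym_pullback //.
have ex : exists T : (K -> K) -> cs_type U -> cs_type U, [/\
    forall D, commutant pi D -> commutant rho (T D),
    forall (c : R[i]) D E, commutant pi D -> commutant pi E ->
      T (c *: D + E) = c *: T D + T E &
    forall D, commutant pi D -> positive_op D ->
      T D = radon_nikodym rho W (submap pi V D \o Lambda)].
  exists (fun D => compression U (lift_op phi S D)).
  split=> [E cE|c E F cE cF|E cE pE].
  - by apply: compression_commutant; exact: (lift_commutant cpL spi mphi).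
  - apply/funext => u; apply: val_inj.
    rewrite !fctE valPlin !val_compression (lift_op_lin cpL spi mphi) //.
    by rewrite !fctE (bounded_op_lin (orth_projection_bounded U)).
  - by rewrite radon_nikodym_pullback.
by have [_ _] := xgetPex (cst (cst 0)) ex; exact.
Qed.

End Pullback.

(** * Sharpness after pullback and reduction by the lifted projection *)

Theorem corollary3p7 (R : realType) (A B : cstarType R)
    (H K L : hilbertType R)
    (Omega : B -> H -> H) (Lambda : A -> B)
    (pi : B -> K -> K) (V : H -> K) (phi : A -> L -> L) (S : K -> L)
    (P : K -> K) :
  completely_positive_op Omega ->
  completely_positive Lambda ->
  minimal_stinespring Omega pi V ->
  minimal_stinespring (pi \o Lambda) phi S ->
  commutant pi P -> projection_op P ->
  let U := pullback_space V phi S in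
  let Q := orth_projection U in
  let Gamma := lift_op phi S in
  (projection_op (transfer_map Lambda pi V phi S P) <->
   Gamma P \o Q = Q \o Gamma P) /\
  sharp pi V (submap pi V P) Omega /\
  projection_op (Gamma P) /\
  (sharp (pullback_rep V phi S) (pullback_op V phi S)
     (submap pi V P \o Lambda) (Omega \o Lambda) <->
   reduces (Gamma P) U).
Proof.
move=> _ cpL mpi mphi cP pP U Q Gamma.
have [[spi bV OmegaE] _] := mpi.
have pGP := lift_op_projection cpL spi mphi cP pP.
have posP := projection_positive pP; have [bP PP _] := pP.
have [_ sP] := (projection_opP bP).1 pP.
(* The complementary projection, written as a linear combination so that [commutant_lin] applies.
   Its submap is [Omega] minus the submap of [P], which gives the order relation. *)
pose P' : K -> K := (-1) *: P + id.
have P'E x : P' x = x - P x by rewrite /P' !fctE scaleN1r addrC.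
have cP' : commutant pi P' by apply: commutant_lin => //; exact: commutant_id.
have pP' : projection_op P'.
  have [bP' _] := cP'; apply/projection_opP => //; split=> [|x y].
    apply/funext => x /=; rewrite !P'E (linB (bounded_op_lin bP)).
    by rewrite -[P (P x)]/((P \o P) x) PP subrr subr0.
  by rewrite !P'E innerBl innerBr sP.
have cpP : completely_positive_op (submap pi V P) by exact: submap_cp.
have leP : cp_le (submap pi V P) Omega.
  rewrite /cp_le (_ : Omega - _ = submap pi V P').
    by apply: submap_cp => //; exact: projection_positive.
  apply/funext => b; apply/funext => x; apply: inner_extl => y.
  rewrite !fctE innerBl !inner_submap // P'E (linB (rep_linear spi b)) innerBl.
  by rewrite OmegaE /= adjoint_inner.
(* The transfer, commutation and reduction conditions all become invariance of [U] under
   [Gamma P]. *)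
rewrite transfer_mapE // compression_projectionP // orth_projection_commuteP //.
rewrite reduces_projectionP //; split; first by [].
split.
  (* In the minimal representation of [Omega] the derivative of the submap is [P] itself. *)
  split=> //; rewrite (radon_nikodymE spi bV (minimal_stinespring_total mpi)
    posP cP) // => b x y.
  by rewrite inner_submap.
split; first exact: pGP.
split=> [[_ _]|UP].
  by rewrite radon_nikodym_pullback // compression_projectionP.
split; first exact: submap_comp_cp.
  (* The difference of the two pullbacks is, by conversion, the pullback of the difference. *)
  exact: (submap_comp_cp cpL leP).
by rewrite radon_nikodym_pullback // compression_projectionP.
Qed.
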